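(* Let $f\colon X\to\mathbb{R}$ be convex, let $g=\min_{i\in I}g_i\colon X\to(-\infty,+\infty]$ be min-convex, and let $\gamma>0$. Suppose that $x^*\in\mathbf{Fix}\,T_{\rm DR}$ and let $(\lambda_n)_{n\in\mathbb{N}}$ be a sequence in $(0,2]$ with $\liminf_{n\to\infty}\lambda_n(2-\lambda_n)>0$. Denote $r:=r(x^*;T_{\rm DR})\in(0,+\infty]$ and consider a sequence $(x_n)_{n\in\mathbb{N}}$ with $x_0\in\operatorname{int}\mathbb{B}(x^*;r)$ given by $$\forall n\in\mathbb{N},\quad y_n\in\operatorname{prox}_{\gamma f}(x_n),\quad z_n\in\operatorname{prox}_{\gamma g}(2y_n-x_n),\quad x_{n+1}=x_n+\lambda_n(z_n-y_n).$$ Then $(x_n)_{n\in\mathbb{N}}$ converges to a point $\overline{x}\in\operatorname{Fix}T_{\rm DR}\cap\mathbb{B}(x^*;r)$. Furthermore, for sufficiently small $r$ (that is, there exists $r'\in(0,r]$ such that the following holds whenever $x_0\in\operatorname{int}\mathbb{B}(x^*;r')$), $\operatorname{prox}_{\gamma f}(\overline{x})$ is a local minimum of $f+g$.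
   Context: $X$ is a real finite-dimensional Hilbert space with norm $\|\cdot\|$. A function $g\colon X\to(-\infty,+\infty]$ is min-convex if $g=\min_{i\in I}g_i$ pointwise, where $I$ is a finite index set and each $g_i\colon X\to(-\infty,+\infty]$ is proper, lower semicontinuous and convex; such a representation is fixed. The Moreau envelope is ${}^{\gamma}h(x):=\inf_{y\in X}\left(h(y)+\frac{1}{2\gamma}\|x-y\|^2\right)$ and the proximity operator is $\operatorname{prox}_{\gamma h}(x):=\{y\in X:h(y)+\frac{1}{2\gamma}\|x-y\|^2={}^{\gamma}h(x)\}$ (single-valued for $h$ proper, lsc and convex, and then identified with its unique element). The Douglas--Rachford splitting operator is $T_{\rm DR}(x):=\{x+z-y:y\in\operatorname{prox}_{\gamma f}(x),\ z\in\operatorname{prox}_{\gamma g}(2y-x)\}$. One has the representation $T_{\rm DR}(x)=\{x+\operatorname{prox}_{\gamma g_i}(2y-x)-y:i\in\phi(x)\}$, where $y:=\operatorname{prox}_{\gamma f}(x)$ and $\phi(x):=\{i\in I:{}^{\gamma}g(2y-x)={}^{\gamma}g_i(2y-x)\}$, and the radius of attraction with respect to it is $r(x^*;T_{\rm DR}):=\sup\{\delta>0:\forall x\in\mathbb{B}(x^*;\delta),\ \phi(x)\subseteq\phi(x^* )\}$, which always lies in $(0,+\infty]$. $\mathbb{B}(x;\delta)$ is the closed ball of center $x$ and radius $\delta$ (all of $X$ if $\delta=+\infty$). $\operatorname{Fix}T:=\{x:x\in T(x)\}$ and $\mathbf{Fix}\,T:=\{x:T(x)=\{x\}\}$. A local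 minimum of a function is a point where the function is finite and which minimizes it over some ball around the point. *)

(* Defs.v *)
From HB Require Import structures.
From mathcomp Require Import all_boot all_order all_algebra.
From mathcomp Require Import all_classical all_reals all_analysis.
Set Implicit Arguments.
Unset Strict Implicit.
Unset Printing Implicit Defensive.
Import Order.TTheory GRing.Theory Num.Theory.
Import numFieldNormedType.Exports.
Local Open Scope classical_set_scope.
Local Open Scope ring_scope.

(* Completeness is not assumed: it follows from the finite dimension. *)
HB.mixin Record NormedModule_isInnerProduct (R : realType) X
    of NormedModule R X := {
  inner : {dot X for @idfun R};
  innerE : forall x : X, inner x x = `|x| ^+ 2
}.

#[short(type="finHilbertType")]
HB.structure Definition FinHilbert (R : realType) :=
  { X of NormedModule R X & Vector R X & NormedModule_isInnerProduct R X }.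

Section convexity.
Context {R : realType} {X : finHilbertType R}.
Implicit Types h : X -> \bar R.
Local Open Scope ereal_scope.

Definition proper h := (forall x, h x != -oo) /\ exists x, h x \is a fin_num.

(* The library's [convex_function] covers real-valued functions only. *)
Definition econvex h := forall (t : R) (x y : X), (0 < t < 1)%R ->
  h (t *: x + (1 - t) *: y)%R <= t%:E * h x + (1 - t)%:E * h y.

(* The last conjunct forces I to be nonempty. *)
Definition min_convex {I : finType} (g : X -> \bar R) (g_ : I -> X -> \bar R) :=
  [/\ forall i, [/\ proper (g_ i), lower_semicontinuous (g_ i) & econvex (g_ i)],
      forall x i, g x <= g_ i x &
      forall x, exists i, g x = g_ i x].

(* The radius may be +oo, in which case the ball is the whole space. *)
Definition cball (x : X) (r : \bar R) : set X := [set u | `|x - u|%:E <= r].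

Definition local_min h (x : X) :=
  h x \is a fin_num /\
  exists2 d : R, (0 < d)%R & forall u, cball x d%:E u -> h x <= h u.

Definition moreau_obj (gamma : R) h (x y : X) : \bar R :=
  h y + ((2 * gamma)^-1 * `|x - y| ^+ 2)%:E.

Definition moreau_env (gamma : R) h (x : X) : \bar R :=
  ereal_inf (range (moreau_obj gamma h x)).

Definition prox (gamma : R) h (x : X) : set X :=
  [set y | moreau_obj gamma h x y = moreau_env gamma h x].

(* The unique element of [prox gamma h x], for h proper, lsc and convex. *)
Definition prox_pt (gamma : R) h (x : X) : X := get (prox gamma h x).

End convexity.

Section douglas_rachford.
Context {R : realType} {X : finHilbertType R} {I : finType}.
Variables (gamma : R) (f : X -> R) (g : X -> \bar R) (g_ : I -> X -> \bar R).

Definition DR (x : X) : set X :=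
  [set w | exists y z, [/\ prox gamma (EFin \o f) x y,
                           prox gamma g (2 *: y - x) z & w = x + z - y]].

Definition active (x : X) : set I :=
  let y := prox_pt gamma (EFin \o f) x in
  [set i | moreau_env gamma g (2 *: y - x) = moreau_env gamma (g_ i) (2 *: y - x)].

Definition attraction_radius (xs : X) : \bar R :=
  ereal_sup [set d%:E | d in
    [set d : R | 0 < d /\
       forall x, cball xs d%:E x -> active x `<=` active xs]].

Definition DR_iteration (lambda : nat -> R) (x y z : nat -> X) :=
  forall n, [/\ prox gamma (EFin \o f) (x n) (y n),
                prox gamma g (2 *: y n - x n) (z n) &
                x n.+1 = x n + lambda n *: (z n - y n)].

End douglas_rachford.

Definition Fix {X : Type} (T : X -> set X) : set X := [set x | T x x].

Definition strongFix {X : Type} (T : X -> set X) : set X :=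
  [set x | T x = [set x]].

(* Main.v *)
Require Import Defs.
From HB Require Import structures.
From mathcomp Require Import all_boot all_order all_algebra.
From mathcomp Require Import all_classical all_reals all_analysis.
From mathcomp Require Import ring lra.
Set Implicit Arguments.
Unset Strict Implicit.
Unset Printing Implicit Defensive.
Import Order.TTheory GRing.Theory Num.Theory.
Import numFieldNormedType.Exports.
Local Open Scope classical_set_scope.
Local Open Scope ring_scope.

(** For a single convex piece [g_ i], monotonicity of the two proximity
    operators makes the relaxed Douglas-Rachford step satisfy
      [|x+ - x'+|^2 <= |x - x'|^2 - l (2 - l) |(z - y) - (z' - y')|^2]
    ([DR_contraction]).  The operator of the min-convex function [g] chooses,
    at each point, one of the pieces that are active there.

    At the strong fixed point [xs] every active piece fixes [xs]
    ([DR_strongFix_piece]).  As long as the iterates stay in the ball of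
    attraction, only pieces active at [xs] are used, so the distance to [xs]
    does not increase, the iterates do stay in the ball, and the residual
    [z n - y n] tends to 0.

    The sequence need not be Fejer monotone with respect to all fixed points,
    because the piece in use changes along the iteration.  Convergence comes
    from the argument for a finite pool of paracontractions.  Let [c] be a
    cluster point, which exists because closed balls are compact.  A piece
    that does not fix [c] moves every point near [c] by an amount bounded away
    from 0 ([DR_residual_nonexpansive]); since the residuals vanish, an
    iterate that is late and close to [c] is moved by a piece fixing [c], and
    so does not get farther from [c].  Hence once close to [c] the sequence
    stays close, and it converges to [c] ([DR_iteration_converges]).  Outer
    semicontinuity of the active index set ([active_outer_semicontinuous])
    shows that one of the pieces fixing [c] is active at [c], so that [c] is a
    fixed point; applied at [xs], it shows that the radius of attraction is
    positive.

    Finally, every fixed point [c] yields a local minimum [p] of [f + g], so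
    that [r' = r] works ([DR_fix_local_min]).  A piece attaining [g p] has [p]
    as its proximal point, and the variational inequalities of [f] and of that
    piece add up to minimality of [p]; the other pieces are strictly larger at
    [p], hence near [p] by lower semicontinuity. *)

(** * Inner product *)

Lemma subrACA (V : zmodType) (x y z t : V) : x - y - (z - t) = x - z - (y - t).
Proof. by rewrite !opprB addrACA [RHS]addrACA [- z + _]addrC. Qed.

Section inner_product.
Context {R : realType} {X : finHilbertType R}.
Implicit Types (x y u : X) (t : R).

Lemma innerC x y : inner x y = inner y x.
Proof. by rewrite (hermitian_subproof x y) expr0 mul1r. Qed.

Lemma innerDr x y u : inner u (x + y) = inner u x + inner u y.
Proof. by rewrite linearDr. Qed.

Lemma innerNr x u : inner u (- x) = - inner u x.
Proof. by rewrite linearNr. Qed.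

Lemma innerZr t x u : inner u (t *: x) = t * inner u x.
Proof. by rewrite linearZr_LR. Qed.

Lemma innerDl x y u : inner (x + y) u = inner x u + inner y u.
Proof. by rewrite ![inner _ u]innerC innerDr. Qed.

Lemma innerNl x u : inner (- x) u = - inner x u.
Proof. by rewrite ![inner _ u]innerC innerNr. Qed.

Lemma innerZl t x u : inner (t *: x) u = t * inner x u.
Proof. by rewrite ![inner _ u]innerC innerZr. Qed.

Definition innerL := (innerDl, innerDr, innerNl, innerNr, innerZl, innerZr).

Lemma sqr_normD x y : `|x + y| ^+ 2 = `|x| ^+ 2 + 2 * inner x y + `|y| ^+ 2.
Proof. by rewrite -!innerE !innerL (innerC y x); ring. Qed.

Lemma inner_le x y : inner x y <= `|x| * `|y|.
Proof.
have : `|x + y| ^+ 2 <= (`|x| + `|y|) ^+ 2.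
  by rewrite lerXn2r ?nnegrE ?addr_ge0// ler_normD.
rewrite sqr_normD; lra.
Qed.

End inner_product.

(** * Compactness and continuity in finite dimension *)

Section finite_dimension.
Context {R : realType} {X : finHilbertType R}.
Implicit Types (x y u : X) (t : R).
Import VectorInternalTheory.

Let toX : 'rV[R]_(dim X) -> X := r2v.

Let basis (i : 'I_(dim X)) : X := toX (delta_mx 0 i).

Let toX_sum v : toX v = \sum_i v 0 i *: basis i.
Proof.
rewrite {1}(row_sum_delta v) /toX linear_sum /=.
by apply: eq_bigr => i _; rewrite linearZ.
Qed.

Let toX_continuous : continuous toX.
Proof.
have -> : toX = fun v => \sum_i v 0 i *: basis i by apply/funext => v; exact: toX_sum.
elim: (index_enum _) => [|i s ih].
  by under eq_fun do rewrite big_nil; exact: cst_continuous.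
under eq_fun do rewrite big_cons; move=> v.
apply: (@cvgD _ _ _ _ (nbhs_filter v)); last exact: ih.
by apply: cvgZr_tmp; exact: coord_continuous.
Qed.

(** Comparison of the norm with the sup norm of coordinates: the constant is
    the inverse of the minimum of the norm over the compact unit sphere of the
    coordinate space. *)
Let norm_coord : exists2 C : R, 0 < C & forall x, `|v2r x| <= C * `|x|.
Proof.
pose S := [set v : 'rV[R]_(dim X) | `|v| = 1].
have norm_c : continuous (fun v => `|toX v|).
  by move=> v; apply: (continuous_comp (@toX_continuous v)); exact: norm_continuous.
(* the sphere is empty exactly in dimension 0 *)
have [[s Ss]|S0] := pselect (S !=set0); last first.
  exists 1 => // x; rewrite mul1r.
  suff -> : v2r x = 0 by rewrite normr0.
  apply/eqP; apply: contra_notT S0 => x0; exists (`|v2r x|^-1 *: v2r x).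
  by rewrite /S /= normrZ normfV normr_id mulVf ?normr_eq0.
have cS : compact S.
  apply: bounded_closed_compact.
    by exists 1; split => // e e1 v /= ->; rewrite ltW.
  have -> : S = (fun v => `|v|) @^-1` [set 1] by [].
  apply: closed_comp; first by move=> v _; exact: norm_continuous.
  exact: closed_eq.
have [|c /set_mem Sc cmin] := EVT_min_rV (ex_intro _ s Ss) cS (f := fun v => `|toX v|).
  exact: continuous_subspaceT.
have c0 : 0 < `|toX c|.
  rewrite normr_gt0; apply/eqP => /(congr1 v2r); rewrite r2vK linear0 => c0.
  by move: Sc; rewrite /S /= c0 normr0 => /eqP; rewrite eq_sym oner_eq0.
exists (`|toX c|^-1); first by rewrite invr_gt0.
move=> x; rewrite mulrC ler_pdivlMr//.
have [->|x0] := eqVneq x 0; first by rewrite linear0 normr0 mul0r normr0.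
have vx0 : 0 < `|v2r x|.
  by rewrite normr_gt0; apply: contra_neq x0 => /(congr1 r2v); rewrite v2rK linear0.
rewrite mulrC -ler_pdivlMr//.
have := cmin (`|v2r x|^-1 *: v2r x); rewrite /toX linearZ /= v2rK normrZ.
rewrite normfV normr_id mulrC; apply; apply/mem_set.
by rewrite /S /= normrZ normfV normr_id mulVf// gt_eqF.
Qed.

Lemma cball_compact x t : compact (cball x t%:E).
Proof.
have [C C0 vC] := norm_coord.
have -> : cball x t%:E = toX @` (toX @^-1` cball x t%:E).
  rewrite eqEsubset; split => u; last by case=> v vb <-.
  by move=> ub; exists (v2r u); rewrite /= /toX v2rK.
apply: continuous_compact; first exact: continuous_subspaceT.
apply: bounded_closed_compact.
  exists (C * (`|x| + t)); split; first exact: num_real.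
  move=> e eC v; rewrite /= /cball /= lee_fin => vt.
  rewrite -(r2vK v); apply: (le_trans (vC _)); apply: (le_trans _ (ltW eC)).
  rewrite ler_pM2l// -[r2v v](subrK x) (le_trans (ler_normD _ _))//.
  by rewrite addrC lerD2l distrC.
have -> : toX @^-1` cball x t%:E = (fun v => `|x - toX v|) @^-1` [set u | u <= t].
  by apply/seteqP; split => v; rewrite /cball /= lee_fin.
apply: closed_comp; last exact: closed_le.
move=> v _; apply: (@cvg_norm _ _ _ _ (nbhs_filter v)).
apply: (@cvgB _ _ _ _ (nbhs_filter v)); [exact: cvg_cst|exact: toX_continuous].
Qed.

(** Convexity with scalars in [[0, 1]] instead of the subtype [{i01 R}]. *)
Definition convex_ineq (f : X -> R) := forall t x y, 0 <= t <= 1 ->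
  f (t *: x + (1 - t) *: y) <= t * f x + (1 - t) * f y.

(** Along a segment a convex function is bounded by its values at the ends.
    Coordinates are then treated one at a time, a sum being the midpoint of its
    doubled first term and its doubled remainder. *)
Lemma convex_locally_bounded f x : convex_ineq f ->
  exists M d, 0 < d /\ forall h, `|h| <= d -> f (x + h) <= M.
Proof.
move=> fc.
have segment e : exists M, forall a, `|a| <= 1 -> f (x + a *: e) <= M.
  exists (Num.max (f (x + e)) (f (x - e))) => a; rewrite ler_norml => /andP[a1 a2].
  set m := Num.max _ _; pose s := (1 + a) / 2.
  have s01 : 0 <= s <= 1 by apply/andP; rewrite /s; split; lra.
  have -> : x + a *: e = s *: (x + e) + (1 - s) *: (x - e).
    rewrite !scalerDr addrACA -scalerDl subrKC scale1r; congr (_ + _).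
    by rewrite scalerN -scalerBl; congr (_ *: _); rewrite /s; field.
  apply: (le_trans (fc _ _ _ s01)); case/andP: s01 => s0 s1.
  have -> : m = s * m + (1 - s) * m by ring.
  by rewrite lerD// ler_wpM2l ?subr_ge0// /m le_max lexx ?orbT.
have box (s : seq (ordinal (dim X))) : exists M d, 0 < d /\
    forall c : ordinal (dim X) -> R, (forall i, `|c i| <= d) ->
      f (x + \sum_(i <- s) c i *: basis i) <= M.
  elim: s => [|i s [M [d [d0 ih]]]].
    by exists (f x), 1; split => // c _; rewrite big_nil addr0.
  have [N Nb] := segment (basis i).
  exists (2^-1 * N + (1 - 2^-1) * M), (Num.min (d / 2) 2^-1); split.
    by rewrite lt_min divr_gt0//= invr_gt0.
  move=> c cd; rewrite big_cons.
  have half : x + (c i *: basis i + \sum_(j <- s) c j *: basis j) =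
      2^-1 *: (x + (2 * c i) *: basis i) +
      (1 - 2^-1) *: (x + \sum_(j <- s) (2 * c j) *: basis j).
    rewrite !scalerDr addrACA -scalerDl subrKC scale1r scalerA mulKf//.
    congr (_ + (_ + _)); rewrite scaler_sumr; apply: eq_bigr => j _.
    by rewrite scalerA; congr (_ *: _); field.
  rewrite half; apply: (le_trans (fc _ _ _ _)); first by apply/andP; split; lra.
  apply: lerD; rewrite ler_wpM2l//.
  - apply: Nb; rewrite normrM ger0_norm// mulrC -ler_pdivlMr// mul1r.
    by apply: le_trans (cd i) _; rewrite ge_min lexx orbT.
  - by lra.
  - apply: ih => j; rewrite normrM ger0_norm// mulrC -ler_pdivlMr//.
    by apply: le_trans (cd j) _; rewrite ge_min lexx.
have [M [d [d0 fM]]] := box (index_enum _).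
have [C C0 vC] := norm_coord.
exists M, (d / C); split; first exact: divr_gt0.
move=> h hd; rewrite -(v2rK h) -/(toX _) toX_sum; apply: fM => i.
apply: le_trans (le_trans (vC h) _); last by rewrite mulrC -ler_pdivlMr.
rewrite [leRHS]mx_normrE.
exact: (le_bigmax 0 (fun ij => `|v2r h ij.1 ij.2|) (0, i)).
Qed.

(** An upper bound near [x] turns into a lower bound: [x] is a convex
    combination of a nearby [y] and of the point [x + t^-1 *: (x - y)] on the
    other side, which stays in the ball where [f] is bounded. *)
Lemma convex_lower_semicontinuous f :
  convex_ineq f -> lower_semicontinuous (EFin \o f).
Proof.
move=> fc x a; rewrite /= lte_fin => afx.
have [M [d [d0 fM]]] := convex_locally_bounded x fc.
have fxM : f x <= M by rewrite -[x]addr0; apply: fM; rewrite normr0 ltW.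
have fa0 : 0 < f x - a by rewrite subr_gt0.
have M0 : 0 < M - f x + 1 by rewrite ltr_wpDl ?subr_ge0.
(* chosen so that t * (M - f x) < f x - a *)
pose t := (f x - a) / (M - f x + 1).
have t0 : 0 < t by exact: divr_gt0.
exists (ball x (t * d)); first by apply: nbhsx_ballx; exact: mulr_gt0.
move=> y; rewrite -ball_normE /= lte_fin => xy.
have s01 : 0 <= (1 + t)^-1 <= 1.
  by rewrite invr_ge0 invf_le1 ?addr_gt0// lerDl addr_ge0// ltW.
have xE : x = (1 + t)^-1 *: y + (1 - (1 + t)^-1) *: (x + t^-1 *: (x - y)).
  have -> : 1 - (1 + t)^-1 = (1 + t)^-1 * t by field; lra.
  rewrite -scalerA -scalerDr [t *: (_ + _)]scalerDr [t *: (_ *: _)]scalerA.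
  rewrite mulfV ?gt_eqF// scale1r addrCA subrKC [t *: x + x]addrC.
  rewrite -[X in _ *: (X + _)]scale1r -scalerDl scalerA.
  by rewrite mulVf ?scale1r// gt_eqF// addr_gt0.
have := fc _ y (x + t^-1 *: (x - y)) s01; rewrite -xE.
have /(fM _) : `|t^-1 *: (x - y)| <= d.
  by rewrite normrZ gtr0_norm ?invr_gt0// mulrC ler_pdivrMr// mulrC ltW.
set N := f (x + _) => NM.
have -> : (1 + t)^-1 * f y + (1 - (1 + t)^-1) * N = (f y + t * N) / (1 + t).
  by field; lra.
rewrite ler_pdivlMr ?addr_gt0// => fxy.
have : t * N <= t * M by rewrite ler_wpM2l// ltW.
have : t * (M - f x + 1) = f x - a by rewrite /t divfK// gt_eqF.
lra.
Qed.

End finite_dimension.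

(** * Proximity operators *)

Local Notation proper := Defs.proper.

(** If no minimum were attained, the traces on [K] of the sublevel sets would
    form a filter base; at a cluster point, lower semicontinuity contradicts
    the existence of a lower value. *)
Lemma lower_semicontinuous_min (R : realType) (T : topologicalType)
    (K : set T) (h : T -> \bar R) :
  compact K -> lower_semicontinuous h -> K !=set0 ->
  exists2 x, K x & forall y, K y -> (h x <= h y)%E.
Proof.
move=> cK lh [x0 Kx0]; apply: contrapT => nomin.
have lower x : K x -> exists2 y, K y & (h y < h x)%E.
  move=> Kx; apply: contrapT => nolower; apply: nomin; exists x => // y Ky.
  by rewrite leNgt; apply/negP => yx; apply: nolower; exists y.
pose F := filter_from K (fun x => K `&` [set u | (h u <= h x)%E]).
have FF : ProperFilter F.
  apply: filter_from_proper; last by move=> x Kx; exists x; split => //=.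
  apply: filter_from_filter; first by exists x0.
  move=> x y Kx Ky; have [xy|yx] := leP (h x) (h y).
    by exists x => // u [Ku /= ux]; split; split => //=; exact: le_trans ux xy.
  by exists y => // u [Ku /= uy]; split; split => //=; exact: le_trans uy (ltW yx).
have FK : F K by exists x0 => // u [].
have [c [Kc Fc]] := cK _ FF FK.
have [y Ky yc] := lower _ Kc; have [z Kz zy] := lower _ Ky.
(* strictly between two values, hence finite *)
have hyE : h y = (fine (h y))%:E.
  rewrite fineK// fin_numE gt_eqF ?(le_lt_trans (leNye _) zy)//=.
  by rewrite lt_eqF// (lt_le_trans yc) ?leey.
rewrite hyE in yc; have [V cV hV] := lh _ _ yc.
have Fy : F (K `&` [set u | (h u <= h y)%E]) by exists y.
have [u [[Ku uy] /hV]] := Fc _ _ Fy cV.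
by rewrite -hyE ltNge uy.
Qed.

Section prox.
Context {R : realType} {X : finHilbertType R}.
Implicit Types (h : X -> \bar R) (x y u : X).

Lemma real_between (a : R) (b : \bar R) :
  (a%:E < b)%E -> exists2 c : R, a < c & (c%:E < b)%E.
Proof.
case: b => [b| |] //=; last by exists (a + 1); rewrite ?ltrDl ?ltry.
by rewrite lte_fin => ab; exists ((a + b) / 2); rewrite ?lte_fin; lra.
Qed.

Lemma lower_semicontinuousD_continuous h (q : X -> R) :
  lower_semicontinuous h -> continuous q ->
  lower_semicontinuous (fun x => h x + (q x)%:E)%E.
Proof.
move=> lh cq x a; rewrite -lteBlDr// -EFinB => /real_between[b ab bh].
have [V xV hV] := lh _ _ bh.
exists (V `&` [set u | a - b < q u]).
  apply: filterI => //; apply: (cvgr_gt (q x)); first exact: cq.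
  by lra.
move=> u [/hV bu /= abu]; rewrite -lteBlDr// -EFinB.
by apply: lt_trans bu; rewrite lte_fin; lra.
Qed.

Variable gamma : R.
Hypothesis gamma_gt0 : 0 < gamma.

Let c_gt0 : 0 < (2 * gamma)^-1.
Proof. by rewrite invr_gt0 mulr_gt0. Qed.

Lemma moreau_env_le h x y : (moreau_env gamma h x <= moreau_obj gamma h x y)%E.
Proof. by apply: ereal_inf_lbound; exists y. Qed.

Lemma proxP h x y : prox gamma h x y <->
  forall u, (moreau_obj gamma h x y <= moreau_obj gamma h x u)%E.
Proof.
split=> [-> u|ymin]; first exact: moreau_env_le.
apply/eqP; rewrite eq_le moreau_env_le andbT.
by apply: le_ereal_inf_tmp => _ [u _ <-].
Qed.

Lemma moreau_obj_lower_semicontinuous h x :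
  lower_semicontinuous h -> lower_semicontinuous (moreau_obj gamma h x).
Proof.
move=> lh; apply: lower_semicontinuousD_continuous => // u.
apply: cvgM; first exact: cvg_cst.
by apply: cvgM; apply: cvg_norm; apply: cvgB;
  [exact: cvg_cst|exact: cvg_id|exact: cvg_cst|exact: cvg_id].
Qed.

(** The function is bounded below on the compact unit ball around a point [x0]
    of its domain, and convexity on the segment from [x0] to [u] propagates
    this bound linearly outwards. *)
Lemma convex_linear_minorant h : proper h -> lower_semicontinuous h ->
  econvex h -> exists x0 a M, [/\ h x0 = a%:E, 0 <= M &
    forall u, ((a - M * (1 + `|x0 - u|))%:E <= h u)%E].
Proof.
move=> [hNy [x0 hx0]] lh hc.
have [p pb pmin] : exists2 p, cball x0 1%:E p &
    forall u, cball x0 1%:E u -> (h p <= h u)%E.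
  apply: lower_semicontinuous_min => //; first exact: cball_compact.
  by exists x0; rewrite /cball /= subrr normr0 lee_fin.
have px0 : (h p <= h x0)%E.
  by apply: pmin; rewrite /cball /= subrr normr0 lee_fin.
have hpE : h p = (fine (h p))%:E.
  rewrite fineK// fin_numE hNy lt_eqF//= (le_lt_trans px0)//.
  by rewrite -(fineK hx0) ltry.
set b := fine (h p) in hpE.
have hx0E := fineK hx0; set a := fine (h x0) in hx0E.
have M0 : 0 <= a - b by rewrite subr_ge0 -lee_fin -hpE hx0E.
exists x0, a, (a - b); split => // u.
have [u1|u1] := leP (`|x0 - u|) 1.
  apply: (@le_trans _ _ (h p)); last by apply: pmin; rewrite /cball /= lee_fin.
  rewrite hpE lee_fin.
  have := mulr_ge0 M0 (normr_ge0 (x0 - u)); lra.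
have u0 : 0 < `|x0 - u| by rewrite (lt_trans _ u1).
have t01 : 0 < `|x0 - u|^-1 < 1 by rewrite invr_gt0 u0 invf_lt1.
have := hc _ u x0 t01.
have /pmin : cball x0 1%:E (`|x0 - u|^-1 *: u + (1 - `|x0 - u|^-1) *: x0).
  rewrite /cball /= lee_fin scalerBl scale1r.
  rewrite (_ : x0 - _ = `|x0 - u|^-1 *: (x0 - u)); last first.
    by rewrite scalerBr opprD opprB addrCA subrKC addrC.
  by rewrite normrZ normfV normr_id mulVf// gt_eqF.
move=> /le_trans/[apply]; rewrite hpE -hx0E.
case: (h u) (hNy u) => [r _| _|//]; last by rewrite leey.
rewrite -!EFinM -EFinD !lee_fin.
set t := `|x0 - u| in u0 *.
have -> : t^-1 * r + (1 - t^-1) * a = (r + (t - 1) * a) / t by field; rewrite gt_eqF.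
by rewrite ler_pdivlMr//; clear -M0; lra.
Qed.

(** The quadratic term beats the linear minorant outside a large ball, so a
    minimum over that compact ball is global. *)
Lemma prox_nonempty h x : proper h -> lower_semicontinuous h -> econvex h ->
  prox gamma h x !=set0.
Proof.
move=> hp lh hc; have [x0 [a [M [hx0 M0 hM]]]] := convex_linear_minorant hp lh hc.
have c0 := c_gt0; set c := (2 * gamma)^-1 in c0 *.
(* beyond this radius the objective exceeds its value at x0 *)
pose D := `|x - x0|; pose rho := 1 + 2 * D + 2 * M / c.
have D0 : 0 <= D by exact: normr_ge0.
have Mc0 : 0 <= 2 * M / c by rewrite divr_ge0 ?mulr_ge0// ltW.
have x0b : cball x0 rho%:E x0.
  by rewrite /cball /= subrr normr0 lee_fin /rho; lra.
have [y yb ymin] := lower_semicontinuous_min (@cball_compact _ _ x0 rho)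
  (moreau_obj_lower_semicontinuous (x := x) lh) (ex_intro _ x0 x0b).
exists y; apply/proxP => u.
have [/ymin//|] := pselect (cball x0 rho%:E u).
rewrite /cball /= => /negP; rewrite -ltNge lte_fin => us.
apply: le_trans (ymin _ x0b) _; rewrite /moreau_obj hx0.
apply: le_trans (leeD2r _ (hM u)); rewrite -!EFinD lee_fin -/c -/D.
set s := `|x0 - u| in us *.
have sD : s - D <= `|x - u|.
  rewrite lerBlDr (le_trans (ler_distD x _ _))// addrC lerD2l.
  by rewrite /D distrC.
have s1 : 1 <= s by move: us; rewrite /rho; lra.
have sD0 : 0 <= s - D by move: us; rewrite /rho; lra.
have sq : (s - D) ^+ 2 <= `|x - u| ^+ 2 by rewrite lerXn2r ?nnegrE.
have csq : c * (s - D) ^+ 2 <= c * `|x - u| ^+ 2 by rewrite ler_pM2l.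
have cs : 2 * D * c + 2 * M <= c * s.
  have -> : 2 * D * c + 2 * M = c * (2 * D + 2 * M / c) by field; rewrite gt_eqF.
  by rewrite ler_pM2l//; move: us; rewrite /rho; lra.
have : (2 * D * c + 2 * M) * s <= c * s * s by rewrite ler_wpM2r//; lra.
have : M * 1 <= M * s by rewrite ler_wpM2l.
clear hx0; lra.
Qed.

Lemma prox_fin_num h x y : proper h -> prox gamma h x y -> h y \is a fin_num.
Proof.
move=> [hNy [x0 hx0]] /proxP/(_ x0); rewrite /moreau_obj -(fineK hx0).
by case: (h y) (hNy y).
Qed.

(** The proximal point [y] is compared with [t *: u + (1 - t) *: y]; division
    by [t] and [t -> 0] leave the first-order term.  This says that
    [gamma^-1 *: (x - y)] is a subgradient of [h] at [y]. *)
Lemma prox_variational h x y u : proper h -> econvex h -> prox gamma h x y ->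
  (h y + (gamma^-1 * inner (x - y) (u - y))%:E <= h u)%E.
Proof.
move=> hp hc pr; have hyE := fineK (prox_fin_num hp pr); case: (hp) => hNy _.
case E : (h u) (hNy u) => [r| |//] _; last by rewrite leey.
rewrite -hyE; set b := fine (h y) in hyE *.
rewrite -EFinD lee_fin; set A := inner _ _; set B := `|u - y| ^+ 2.
have B0 : 0 <= B by exact: exprn_ge0.
have c0 := c_gt0; set c := (2 * gamma)^-1 in c0 *.
have -> : gamma^-1 = 2 * c by rewrite /c; field; rewrite gt_eqF.
have step t : 0 < t < 1 -> 2 * c * A - t * (c * B) <= r - b.
  move=> /andP[t0 t1]; have := hc t u y; rewrite t0 t1 => /(_ isT).
  move/proxP: pr => /(_ (t *: u + (1 - t) *: y)).
  rewrite /moreau_obj -hyE -/b E -/c.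
  have -> : x - (t *: u + (1 - t) *: y) = (x - y) + (- t) *: (u - y).
    rewrite (_ : t *: u + _ = y + t *: (u - y)) ?opprD ?addrA ?scaleNr//.
    by rewrite scalerBl scale1r scalerBr addrCA.
  rewrite (sqr_normD (x - y)) innerZr -/A normrZ exprMn normrN ger0_norm ?(ltW t0)//.
  rewrite -/B => h1 h2.
  have := le_trans h1 (leeD2r _ h2).
  rewrite -?EFinM -?EFinD lee_fin => h3.
  have : t * (2 * c * A - t * (c * B)) <= t * (r - b) by lra.
  by rewrite ler_pM2l.
rewrite leNgt; apply/negP => lt_r.
have cB0 : 0 <= c * B by rewrite mulr_ge0// ltW.
(* t is taken so small that t * (c * B) < d *)
pose d := b + 2 * c * A - r; have d0 : 0 < d by rewrite /d; lra.
pose t := Num.min 2^-1 (d / (c * B + 1)).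
have /step : 0 < t < 1.
  apply/andP; split; last by rewrite gt_min invf_lt1 ?ltr1n.
  rewrite lt_min invr_gt0 ltr0n /=; apply: divr_gt0 => //.
  exact: ltr_wpDl.
have : t * (c * B) < d.
  have t2 : t <= d / (c * B + 1) by rewrite ge_min lexx orbT.
  apply: (@le_lt_trans _ _ (d / (c * B + 1) * (c * B))); first exact: ler_wpM2r.
  by rewrite mulrAC ltr_pdivrMr ?ltr_wpDl// ltr_pM2l// ltrDl.
rewrite /d; lra.
Qed.

Lemma prox_monotone h x x' y y' : proper h -> econvex h ->
  prox gamma h x y -> prox gamma h x' y' ->
  0 <= inner (y - y') ((x - y) - (x' - y')).
Proof.
move=> hp hc py py'.
have := prox_variational y hp hc py'; have := prox_variational y' hp hc py.
rewrite -(fineK (prox_fin_num hp py)) -(fineK (prox_fin_num hp py')) -!EFinD.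
rewrite !lee_fin => h1 h2.
have : gamma^-1 * (inner (x - y) (y' - y) + inner (x' - y') (y - y')) <= 0 by lra.
rewrite pmulr_rle0 ?invr_gt0// => h3.
have -> : inner (y - y') (x - y - (x' - y')) =
  - (inner (x - y) (y' - y) + inner (x' - y') (y - y')).
  by rewrite innerC !innerL; ring.
by rewrite oppr_ge0.
Qed.

Lemma prox_unique h x y y' : proper h -> econvex h ->
  prox gamma h x y -> prox gamma h x y' -> y = y'.
Proof.
move=> hp hc py py'; have := prox_monotone hp hc py py'.
have -> : x - y - (x - y') = - (y - y') by rewrite opprB opprB addrC addrA subrK addrC.
rewrite innerNr innerE oppr_ge0 => y0.
apply/eqP; rewrite -subr_eq0 -normr_eq0 -sqrf_eq0 eq_le y0.
exact: exprn_ge0.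
Qed.

Lemma prox_ptE h x y : proper h -> econvex h ->
  prox gamma h x y -> prox_pt gamma h x = y.
Proof.
move=> hp hc py; apply: (prox_unique hp hc (x := x)) => //.
by apply: getPex; exists y.
Qed.

End prox.

Section real_convex.
Context {R : realType} {X : finHilbertType R}.
Variable f : X -> R.
Hypothesis f_convex : convex_function [set: convex_lmodType X] f.

Lemma convex_function_ineq : convex_ineq f.
Proof.
move=> t x y /andP[t0 t1].
by have := f_convex (Itv01 t0 t1) (mem_setT x) (mem_setT y); rewrite convRE.
Qed.

Lemma convex_function_econvex : econvex (EFin \o f).
Proof.
move=> t x y /andP[t0 t1]; rewrite /= -!EFinM -EFinD lee_fin.
by apply: convex_function_ineq; rewrite !ltW.
Qed.

Lemma convex_function_proper : proper (EFin \o f).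
Proof. by split => //; exists 0. Qed.

End real_convex.

(** * The Douglas-Rachford step for a convex piece *)

Section douglas_rachford_step.
Context {R : realType} {X : finHilbertType R}.
Variable gamma : R.
Hypothesis gamma_gt0 : 0 < gamma.
Variable f : X -> \bar R.
Hypotheses (f_proper : proper f) (f_convex : econvex f).
Implicit Types (h : X -> \bar R) (x y z : X).

(** The contraction estimate in terms of the differences [a], [b], [d] of the
    points [y], [z], [x] of two steps: adding the two monotonicity
    inequalities gives [inner d (b - a) <= - |b - a| ^+ 2]. *)
Lemma reflected_monotone_contraction (a b d : X) (l : R) : 0 <= l ->
  0 <= inner a (d - a) -> 0 <= inner b (2 *: a - d - b) ->
  `|d + l *: (b - a)| ^+ 2 <= `|d| ^+ 2 - l * (2 - l) * `|b - a| ^+ 2.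
Proof.
move=> l0 ha hb; rewrite (sqr_normD d) normrZ exprMn (ger0_norm l0) innerZr.
have hd : inner d (b - a) <= - `|b - a| ^+ 2.
  move: ha hb; rewrite -!innerE !innerL (innerC b a) (innerC b d) (innerC a d).
  lra.
have := ler_wpM2l l0 hd; lra.
Qed.

Lemma prox_nonexpansive h x x' y y' : proper h -> econvex h ->
  prox gamma h x y -> prox gamma h x' y' -> `|y - y'| <= `|x - x'|.
Proof.
move=> hp hc py py'; have := prox_monotone gamma_gt0 hp hc py py'.
rewrite subrACA innerDr innerNr innerE subr_ge0 => /le_trans/(_ (inner_le _ _)).
have [->|yy'] := eqVneq (y - y') 0; first by rewrite normr0.
by rewrite expr2 ler_pM2l// normr_gt0.
Qed.

Lemma DR_contraction h x x' y y' z z' l : proper h -> econvex h -> 0 <= l ->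
  prox gamma f x y -> prox gamma f x' y' ->
  prox gamma h (2 *: y - x) z -> prox gamma h (2 *: y' - x') z' ->
  `|(x + l *: (z - y)) - (x' + l *: (z' - y'))| ^+ 2 <=
    `|x - x'| ^+ 2 - l * (2 - l) * `|(z - y) - (z' - y')| ^+ 2.
Proof.
move=> hp hc l0 py py' pz pz'.
have ha : 0 <= inner (y - y') ((x - x') - (y - y')).
  have := prox_monotone gamma_gt0 f_proper f_convex py py'.
  by congr (_ <= _); rewrite !innerL; ring.
have hb : 0 <= inner (z - z') (2 *: (y - y') - (x - x') - (z - z')).
  have := prox_monotone gamma_gt0 hp hc pz pz'.
  by congr (_ <= _); rewrite !innerL; ring.
have := reflected_monotone_contraction l0 ha hb.
rewrite (subrACA z).
suff -> : x + l *: (z - y) - (x' + l *: (z' - y')) =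
  x - x' + l *: (z - y - (z' - y')) by [].
by rewrite (scalerBr l (z - y)) opprD addrACA.
Qed.

(** Relaxation 1 in [DR_contraction] makes the coefficient [l * (2 - l)] equal
    to 1. *)
Lemma DR_residual_nonexpansive h x x' y y' z z' : proper h -> econvex h ->
  prox gamma f x y -> prox gamma f x' y' ->
  prox gamma h (2 *: y - x) z -> prox gamma h (2 *: y' - x') z' ->
  `|(z - y) - (z' - y')| <= `|x - x'|.
Proof.
move=> hp hc py py' pz pz'.
have := DR_contraction hp hc ler01 py py' pz pz'.
rewrite (_ : 1 * (2 - 1) = 1 :> R); last by ring.
rewrite mul1r => /(le_trans (exprn_ge0 _ (normr_ge0 _))).
by rewrite subr_ge0 ler_pXn2r ?nnegrE.
Qed.

End douglas_rachford_step.

(** * Min-convex functions *)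

Section min_convex.
Context {R : realType} {X : finHilbertType R} {I : finType}.
Variables (gamma : R) (g : X -> \bar R) (g_ : I -> X -> \bar R).
Hypotheses (gamma_gt0 : 0 < gamma) (g_min_convex : min_convex g g_).
Implicit Types (x w z : X) (i : I).

Lemma piece_proper i : proper (g_ i).
Proof. by have [/(_ i)[]] := g_min_convex. Qed.

Lemma piece_lsc i : lower_semicontinuous (g_ i).
Proof. by have [/(_ i)[]] := g_min_convex. Qed.

Lemma piece_convex i : econvex (g_ i).
Proof. by have [/(_ i)[]] := g_min_convex. Qed.

Lemma min_convex_le x i : (g x <= g_ i x)%E.
Proof. by have [_ + _] := g_min_convex; apply. Qed.

Lemma min_convex_attained x : exists i, g x = g_ i x.
Proof. by have [_ _] := g_min_convex. Qed.

Lemma min_convex_proper : proper g.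
Proof.
split=> [x|]; first by have [i ->] := min_convex_attained x; have [] := piece_proper i.
have [i _] := min_convex_attained 0; have [_ [x xfin]] := piece_proper i.
exists x; have [j gj] := min_convex_attained x; have [jNy _] := piece_proper j.
rewrite fin_numE gj jNy -gj lt_eqF// (le_lt_trans (min_convex_le x i))//.
by rewrite -(fineK xfin) ltry.
Qed.

Lemma moreau_obj_le w u i : (moreau_obj gamma g w u <= moreau_obj gamma (g_ i) w u)%E.
Proof. by rewrite leeD2r// min_convex_le. Qed.

(** Since [g] lies below its pieces, minimizing the objective of [g] with value
    attained by a piece also minimizes the objective of that piece. *)
Lemma prox_piece w z i : prox gamma g w z -> g z = g_ i z ->
  prox gamma (g_ i) w z /\ moreau_env gamma g w = moreau_env gamma (g_ i) w.
Proof.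
move=> pz gz; have pi : prox gamma (g_ i) w z.
  apply/proxP => u; apply: (le_trans _ (moreau_obj_le w u i)).
  by rewrite {1}/moreau_obj -gz; have /proxP := pz; apply.
by split => //; rewrite -pz -pi /moreau_obj gz.
Qed.

Lemma prox_min_convex w z i : prox gamma (g_ i) w z ->
  moreau_env gamma g w = moreau_env gamma (g_ i) w -> prox gamma g w z.
Proof.
move=> pz env; apply/proxP => u; apply: le_trans (moreau_obj_le _ _ i) _.
by rewrite pz -env moreau_env_le.
Qed.

Lemma piece_prox_nonempty w i : prox gamma (g_ i) w !=set0.
Proof.
by apply: prox_nonempty => //;
  [exact: piece_proper|exact: piece_lsc|exact: piece_convex].
Qed.

(** The best among the proximal points of the finitely many pieces. *)
Lemma min_convex_prox_nonempty w : prox gamma g w !=set0.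
Proof.
have [i0 _] := min_convex_attained w.
have [p pP] : {p : I -> X & forall i, prox gamma (g_ i) w (p i)}.
  by apply: (choice (fun i => piece_prox_nonempty w i)).
pose m := [arg min_(i < i0) moreau_obj gamma (g_ i) w (p i)]%O.
exists (p m); apply/proxP => u; have [j gj] := min_convex_attained u.
apply: le_trans (moreau_obj_le _ _ m) _.
rewrite /m; case: arg_minP => // i _ imin.
apply: le_trans (imin j isT) _; rewrite {2}/moreau_obj gj.
by have /proxP := pP j; apply.
Qed.

End min_convex.

(** * Active pieces and fixed points *)

Section douglas_rachford.
Context {R : realType} {X : finHilbertType R} {I : finType}.
Variables (gamma : R) (f : X -> R) (g : X -> \bar R) (g_ : I -> X -> \bar R).
Hypotheses (gamma_gt0 : 0 < gamma) (g_min_convex : min_convex g g_).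
Hypothesis f_convex : convex_function [set: convex_lmodType X] f.
Implicit Types (x y z : X) (i : I).

Let fE : X -> \bar R := EFin \o f.
Let fE_proper : proper fE := convex_function_proper f.
Let fE_convex : econvex fE := convex_function_econvex f_convex.

Lemma convex_prox_pt x : prox gamma (EFin \o f) x (prox_pt gamma (EFin \o f) x).
Proof.
apply: getPex; apply: prox_nonempty => //.
exact/convex_lower_semicontinuous/convex_function_ineq.
Qed.

Let yp x := prox_pt gamma (EFin \o f) x.

Let prox_yp x y : prox gamma (EFin \o f) x y -> y = yp x.
Proof. by move=> py; rewrite /yp (prox_ptE gamma_gt0 _ _ py). Qed.

(** If the envelope of piece [i] exceeds that of [g] by [gap > 0] at the
    reflected point [w], then activity of [i] at [u] bounds [gap] by
    [2 * c * inner (w - w') (pg - q)], where [w'] is the reflected point of [u],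
    [pg] a proximal point of [g] at [w] and [q] that of piece [i] at [w'].
    This is small when [u] is close to [x], because proximity operators are
    nonexpansive. *)
Lemma active_or_inactive_near x i : active gamma f g g_ x i \/
  \forall u \near x, ~ active gamma f g g_ u i.
Proof.
have [|nact] := pselect (active gamma f g g_ x i); [by left|right].
pose w := 2 *: yp x - x.
have [pg pgP] := min_convex_prox_nonempty gamma_gt0 g_min_convex w.
have [p pP] := piece_prox_nonempty gamma_gt0 g_min_convex w i.
have gp := min_convex_proper g_min_convex.
have gip := piece_proper g_min_convex i; have gic := piece_convex g_min_convex i.
have pgE := fineK (prox_fin_num gp pgP); have pE := fineK (prox_fin_num gip pP).
set G := fine _ in pgE; set P := fine _ in pE.
have c0 : 0 < (2 * gamma)^-1 by rewrite invr_gt0 mulr_gt0.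
set c := (2 * gamma)^-1 in c0.
pose gap := (P + c * `|w - p| ^+ 2) - (G + c * `|w - pg| ^+ 2).
have gap0 : 0 < gap.
  rewrite subr_gt0 -lte_fin.
  have -> : (G + c * `|w - pg| ^+ 2)%:E = moreau_env gamma g w.
    by rewrite -pgP /moreau_obj -pgE.
  have -> : (P + c * `|w - p| ^+ 2)%:E = moreau_env gamma (g_ i) w.
    by rewrite -pP /moreau_obj -pE.
  rewrite lt_neqAle; apply/andP; split; first exact/eqP.
  rewrite -pP; apply: (le_trans (moreau_env_le _ _ _ p)).
  exact: moreau_obj_le.
pose B := `|p - pg|; have B0 : 0 <= B by exact: normr_ge0.
(* |w - w'| <= 3 s and |pg - q| <= 3 + B for s = |x - u| <= 1 *)
have k0 : 0 < 6 * c * (3 + B) by rewrite !mulr_gt0// ltr_wpDr.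
pose d := Num.min 1 (gap / (6 * c * (3 + B))).
have d0 : 0 < d by rewrite lt_min ltr01 /=; exact: divr_gt0.
apply/nbhs_ballP; exists d => //= u; rewrite -ball_normE /= => ud act.
set s := `|x - u| in ud.
have s0 : 0 <= s by exact: normr_ge0.
have [s1 sgap] : s < 1 /\ s * (6 * c * (3 + B)) < gap.
  by move: ud; rewrite /d lt_min => /andP[s1]; rewrite ltr_pdivlMr.
pose w' := 2 *: yp u - u.
have ww : `|w - w'| <= 3 * s.
  have yy : `|yp x - yp u| <= s.
    exact: (prox_nonexpansive gamma_gt0 fE_proper fE_convex
      (convex_prox_pt x) (convex_prox_pt u)).
  have -> : w - w' = 2 *: (yp x - yp u) - (x - u).
    by rewrite scalerBr subrACA.
  apply: le_trans (ler_normB _ _) _.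
  by rewrite normrZ ger0_norm// -/s; lra.
have [q qP] := piece_prox_nonempty gamma_gt0 g_min_convex w' i.
have qE := fineK (prox_fin_num gip qP); set Q := fine _ in qE.
have pq : `|q - p| <= 3 * s.
  by apply: le_trans ww; rewrite distrC;
    exact: (prox_nonexpansive gamma_gt0 gip gic pP qP).
have le1 : P + c * `|w - p| ^+ 2 <= Q + c * `|w - q| ^+ 2.
  by move/proxP: pP => /(_ q); rewrite /moreau_obj -pE -qE -!EFinD lee_fin.
have le2 : Q + c * `|w' - q| ^+ 2 <= G + c * `|w' - pg| ^+ 2.
  have : (moreau_obj gamma (g_ i) w' q <= moreau_obj gamma g w' pg)%E.
    by rewrite qP -act moreau_env_le.
  by rewrite /moreau_obj -pgE -qE -!EFinD lee_fin.
have gapE : gap <= 2 * c * inner (w - w') (pg - q).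
  have : gap <= c * (`|w - q| ^+ 2 - `|w' - q| ^+ 2 + `|w' - pg| ^+ 2 - `|w - pg| ^+ 2).
    by rewrite /gap; clear pE pgE qE; lra.
  (* w and w' have to stay atoms in the expansion *)
  clearbody w w'; congr (_ <= _); rewrite -!innerE !innerL.
  rewrite (innerC q w) (innerC q w') (innerC pg w) (innerC pg w').
  by ring.
have qpg : `|pg - q| <= 3 + B.
  rewrite (le_trans (ler_distD p _ _))// addrC /B (distrC p pg) lerD2r distrC.
  by rewrite (le_trans pq)//; clear pE pgE qE; lra.
have : inner (w - w') (pg - q) <= 3 * s * (3 + B).
  apply: le_trans (inner_le _ _) _; apply: ler_pM => //.
move=> /(ler_wpM2l (ltW c0)) cin.
clear pE pgE qE; lra.
Qed.

Lemma active_outer_semicontinuous x :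
  \forall u \near x, active gamma f g g_ u `<=` active gamma f g g_ x.
Proof.
have : \forall u \near x, forall i, active gamma f g g_ u i -> active gamma f g g_ x i.
  apply: filter_forall => i; have [ai|] := active_or_inactive_near x i.
    exact: nearW.
  by apply: filterS => u nai /nai.
by apply: filterS.
Qed.

Lemma DR_fixE x : Fix (DR gamma f g) x <-> prox gamma g (2 *: yp x - x) (yp x).
Proof.
split=> [[y [z [py pz xzy]]]|pz].
  have /eqP : z - y = 0 by apply: (addrI x); rewrite addr0 addrA.
  by rewrite -(prox_yp py) subr_eq0 => /eqP zy; rewrite -{2}zy.
by exists (yp x), (yp x); split => //; [exact: convex_prox_pt|rewrite addrK].
Qed.

(** Each active piece contributes its own point to the set [DR gamma f g x],
    which is a singleton. *)
Lemma DR_strongFix_piece x i : strongFix (DR gamma f g) x ->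
  active gamma f g g_ x i -> prox gamma (g_ i) (2 *: yp x - x) (yp x).
Proof.
move=> fx ai.
have [p pP] := piece_prox_nonempty gamma_gt0 g_min_convex (2 *: yp x - x) i.
have : DR gamma f g x (x + p - yp x).
  exists (yp x), p; split => //; first exact: convex_prox_pt.
  exact: (prox_min_convex g_min_convex pP).
rewrite fx => /= /eqP; rewrite -subr_eq0 addrAC [x + p]addrC addrK subr_eq0.
by move=> /eqP py; rewrite -{2}py.
Qed.

(** Pieces attaining [g y] have [y] as proximal point, and their subgradient
    [gamma^-1 *: (y - x)] cancels the subgradient [gamma^-1 *: (x - y)] of [f];
    the others stay above by lower semicontinuity. *)
Lemma DR_fix_local_min x : Fix (DR gamma f g) x ->
  local_min (fun u => ((f u)%:E + g u)%E) (yp x).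
Proof.
move=> /DR_fixE pz; set y := yp x in pz *; set w := 2 *: y - x in pz.
have py : prox gamma (EFin \o f) x y by exact: convex_prox_pt.
have gp := min_convex_proper g_min_convex.
have gfin := prox_fin_num gp pz; have gE := fineK gfin.
split; first by rewrite fin_numD gfin.
suff : \forall u \near y, ((f y)%:E + g y <= (f u)%:E + g u)%E.
  move=> /nbhs_ballP[d /= d0 dP]; exists (d / 2); first exact: divr_gt0.
  move=> u; rewrite /cball /= lee_fin => yu; apply: dP; rewrite -ball_normE /=.
  by apply: le_lt_trans yu _; rewrite ltr_pdivrMr// ltr_pMr// ltr1n.
suff : \forall u \near y, forall i, ((f y)%:E + g y <= (f u)%:E + g_ i u)%E.
  by apply: filterS => u ui; have [i ->] := min_convex_attained g_min_convex u.
have flsc : lower_semicontinuous (EFin \o f).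
  exact/convex_lower_semicontinuous/convex_function_ineq.
apply: filter_forall => i.
have [giy|giy] := eqVneq (g y) (g_ i y).
  apply: nearW => u; have [pi _] := prox_piece g_min_convex pz giy.
  have := prox_variational gamma_gt0 u fE_proper fE_convex py.
  have := prox_variational gamma_gt0 u (piece_proper g_min_convex i)
    (piece_convex g_min_convex i) pi.
  rewrite -giy -gE /fE /= => h1 h2.
  have := leeD h2 h1; rewrite -!EFinD; apply: le_trans.
  rewrite lee_fin.
  have -> : inner (w - y) (u - y) = - inner (x - y) (u - y).
    by rewrite /w !innerL; ring.
  by rewrite mulrN addrACA subrr addr0.
have ylt : (g y < g_ i y)%E by rewrite lt_neqAle giy min_convex_le.
rewrite -gE in ylt; have [b gb] := real_between ylt.
move=> /(piece_lsc g_min_convex)[V yV Vb].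
have : ((f y - (b - fine (g y)))%:E < fE y)%E
  by rewrite /fE /= lte_fin ltrBlDr ltrDl subr_gt0.
move=> /flsc[W yW Wf].
have : nbhs y (V `&` W) by exact: filterI.
apply: filterS => u [/Vb /ltW bu /Wf /ltW fu].
apply: le_trans (leeD fu bu); rewrite -gE -!EFinD lee_fin.
by rewrite opprB addrA subrK.
Qed.

End douglas_rachford.

(** * Convergence of the iteration *)

Lemma limn_einf_gt0 (R : realType) (u : nat -> R) :
  (0 < limn_einf (fun n => (u n)%:E))%E ->
  exists2 e : R, 0 < e & \forall n \near \oo, e <= u n.
Proof.
rewrite limn_einf_lim => u0.
have : einfs (fun n => (u n)%:E) @ \oo -->
    ereal_sup (range (einfs (fun n => (u n)%:E))).
  exact/ereal_nondecreasing_cvgn/nondecreasing_einfs.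
move/cvg_lim => lim_sup; move: u0; rewrite lim_sup// => /ereal_sup_gt[_ [N _ <-]].
move=> /real_between[e e0 eN]; exists e => //; exists N => // n /= Nn.
by rewrite -lee_fin (le_trans (ltW eN))//; apply: ereal_inf_lbound; exists n.
Qed.

Lemma nonincreasing_decrement_small (R : realType) (a : nat -> R) (e : R) :
  (forall n, 0 <= a n) -> (forall n, a n.+1 <= a n) -> 0 < e ->
  \forall n \near \oo, a n - a n.+1 < e.
Proof.
move=> a0 adec e0.
have na : nonincreasing_seq a by apply/nonincreasing_seqP.
have lb : has_lbound (range a) by exists 0 => _ [n _ <-].
have cva : cvgn a by apply: nonincreasing_is_cvgn.
have := cvgr_lt (limn a) cva (limn a + e); rewrite ltrDl => /(_ _ e0).
apply: filterS => n an; have := nonincreasing_cvgn_ge na cva n.+1.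
lra.
Qed.

Section douglas_rachford_convergence.
Context {R : realType} {X : finHilbertType R} {I : finType}.
Variables (gamma : R) (f : X -> R) (g : X -> \bar R) (g_ : I -> X -> \bar R).
Hypotheses (gamma_gt0 : 0 < gamma) (g_min_convex : min_convex g g_).
Hypothesis f_convex : convex_function [set: convex_lmodType X] f.
Implicit Types (i : I).

Let fE : X -> \bar R := EFin \o f.
Let fE_proper : proper fE := convex_function_proper f.
Let fE_convex : econvex fE := convex_function_econvex f_convex.
Let gp := piece_proper g_min_convex.
Let gc := piece_convex g_min_convex.

Let yp (x : X) := prox_pt gamma (EFin \o f) x.

Variables (xs : X) (lambda : nat -> R) (x y z : nat -> X) (d : R).
Hypothesis xs_fix : strongFix (DR gamma f g) xs.
Hypothesis lambda_in : forall n, 0 < lambda n <= 2.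
Hypothesis lambda_liminf :
  (0 < limn_einf (fun n => (lambda n * (2 - lambda n))%:E))%E.
Hypothesis xyz : DR_iteration gamma f g lambda x y z.
Hypothesis d_attract : forall u, cball xs d%:E u ->
  active gamma f g g_ u `<=` active gamma f g g_ xs.
Hypothesis x0_d : `|xs - x 0%N| <= d.

Let yE n : y n = yp (x n).
Proof.
by have [yn _ _] := xyz n; rewrite /yp (prox_ptE gamma_gt0 _ _ yn).
Qed.

Let iteration_piece n : exists i, active gamma f g g_ (x n) i /\
  prox gamma (g_ i) (2 *: y n - x n) (z n).
Proof.
have [_ zn _] := xyz n; have [i gi] := min_convex_attained g_min_convex (z n).
have [pi env] := prox_piece g_min_convex zn gi.
by exists i; rewrite /active /= -/(yp (x n)) -yE.
Qed.

Let lambda_ge0 n : 0 <= lambda n.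
Proof. by case/andP: (lambda_in n) => /ltW. Qed.

Let lambda2_ge0 n : 0 <= lambda n * (2 - lambda n).
Proof. by rewrite mulr_ge0// subr_ge0; case/andP: (lambda_in n). Qed.

Let step_towards_fixpoint c i n : prox gamma (g_ i) (2 *: y n - x n) (z n) ->
  prox gamma (g_ i) (2 *: yp c - c) (yp c) ->
  `|c - x n.+1| ^+ 2 <=
    `|c - x n| ^+ 2 - lambda n * (2 - lambda n) * `|z n - y n| ^+ 2.
Proof.
move=> zi ci; have [yn _ ->] := xyz n.
have := DR_contraction gamma_gt0 fE_proper fE_convex (gp i) (@gc i) (lambda_ge0 n) yn
  (convex_prox_pt gamma_gt0 f_convex c) zi ci.
by rewrite subrr scaler0 addr0 subr0 ![`|_ - c|]distrC.
Qed.

Let fejer_step n : `|xs - x n| <= d ->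
  `|xs - x n.+1| ^+ 2 <=
    `|xs - x n| ^+ 2 - lambda n * (2 - lambda n) * `|z n - y n| ^+ 2.
Proof.
move=> xd; have [i [ai zi]] := iteration_piece n.
apply: (step_towards_fixpoint zi).
apply: (DR_strongFix_piece gamma_gt0 g_min_convex f_convex xs_fix).
by apply: d_attract ai; rewrite /cball /= lee_fin.
Qed.

Let norm_decrease (c : X) n :
  `|c - x n.+1| ^+ 2 <=
    `|c - x n| ^+ 2 - lambda n * (2 - lambda n) * `|z n - y n| ^+ 2 ->
  `|c - x n.+1| <= `|c - x n|.
Proof.
move=> h; rewrite -(@ler_pXn2r _ 2)// ?nnegrE//; apply: le_trans h _.
by rewrite gerBl mulr_ge0// exprn_ge0.
Qed.

Let iterates_bounded n : `|xs - x n| <= `|xs - x 0%N|.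
Proof.
elim: n => // n ih; apply: (le_trans _ ih).
by apply/norm_decrease/fejer_step; exact: le_trans ih x0_d.
Qed.

Let residual_small e : 0 < e -> \forall n \near \oo, `|z n - y n| < e.
Proof.
move=> e0; have [l l0 lP] := limn_einf_gt0 lambda_liminf.
have fejer n := fejer_step (le_trans (iterates_bounded n) x0_d).
have dec n : `|xs - x n.+1| ^+ 2 <= `|xs - x n| ^+ 2.
  by rewrite ler_pXn2r ?nnegrE//; exact: norm_decrease.
have sq0 n : 0 <= `|xs - x n| ^+ 2 by exact: exprn_ge0.
have le0 : 0 < l * e ^+ 2 by rewrite mulr_gt0// exprn_gt0.
have small := nonincreasing_decrement_small sq0 dec le0.
apply: filterS2 lP small => n ln sn.
rewrite -(@ltr_pXn2r _ 2)// ?nnegrE ?(ltW e0)//.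
rewrite -(ltr_pM2l l0); apply: le_lt_trans sn.
apply: (@le_trans _ _ (lambda n * (2 - lambda n) * `|z n - y n| ^+ 2)).
  by rewrite ler_wpM2r// exprn_ge0.
by have := fejer n; lra.
Qed.

Let cluster_point : exists2 c, `|xs - c| <= `|xs - x 0%N| &
  forall e, 0 < e -> forall N, exists2 n, (N <= n)%N & `|c - x n| < e.
Proof.
have Fx : (x @ \oo) (cball xs (`|xs - x 0%N|)%:E).
  by exists 0%N => // n _; rewrite /cball /= lee_fin.
have [c [cb cc]] := cball_compact (fmap_proper_filter x eventually_filter) Fx.
exists c; first by move: cb; rewrite /cball /= lee_fin.
move=> e e0 N; have xN : (x @ \oo) (x @` [set n | (N <= n)%N]).
  by exists N => // n /= Nn; exists n.
have [_ [[n Nn <-]]] := cc _ _ xN (nbhsx_ballx c e e0).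
by rewrite -ball_normE => ?; exists n.
Qed.

(** A piece whose proximal point differs from [yp c] at the reflection of [c]
    has a displacement at [c] of positive norm.  Displacements are nonexpansive,
    so such a piece cannot make a small displacement near [c]; finitely many
    pieces allow a uniform threshold [e]. *)
Let good_pieces c : exists2 e, 0 < e &
  forall n, `|c - x n| < e -> `|z n - y n| < e ->
  forall i, prox gamma (g_ i) (2 *: y n - x n) (z n) ->
    prox gamma (g_ i) (2 *: yp c - c) (yp c).
Proof.
have [p pP] : {p : I -> X & forall i, prox gamma (g_ i) (2 *: yp c - c) (p i)}.
  by apply: (choice (fun i => piece_prox_nonempty gamma_gt0 g_min_convex _ i)).
have : \forall e \near 0^'+, forall i, p i != yp c -> e < `|p i - yp c| / 2.
  apply: filter_forall => i; have [pi|pi] := eqVneq (p i) (yp c); first exact: nearW.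
  near=> e => _; near: e; apply: nbhs_right_lt.
  by rewrite divr_gt0// normr_gt0 subr_eq0.
move=> eP; have [e [e0 {}eP]] : exists e : R, 0 < e /\
    forall i, p i != yp c -> e < `|p i - yp c| / 2.
  have : \forall e \near (0:R)^'+, 0 < e /\
      forall i, p i != yp c -> e < `|p i - yp c| / 2.
    by apply: filterI => //; exact: nbhs_right_gt.
  by move/filter_ex.
exists e => // n xe ze i zi.
have [pic|picN] := eqVneq (p i) (yp c); first by rewrite -{2}pic.
have := eP i picN.
have [yn _ _] := xyz n.
have := DR_residual_nonexpansive gamma_gt0 fE_proper fE_convex (gp i) (@gc i) yn
  (convex_prox_pt gamma_gt0 f_convex c) zi (pP i).
rewrite -/(yp c) [`|x n - c|]distrC => pz.
have := ler_distD (z n - y n) 0 (p i - yp c); rewrite !sub0r !normrN.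
lra.
Unshelve. all: by end_near.
Qed.

(** The limit is a cluster point [c]: by [good_pieces] the distance to [c]
    does not increase from the first late iterate close to [c] onwards. *)
Lemma DR_iteration_converges : exists c : X,
  [/\ x @ \oo --> c, Fix (DR gamma f g) c & `|xs - c| <= `|xs - x 0%N|].
Proof.
have [c cb cc] := cluster_point; exists c.
have [e e0 eP] := good_pieces c.
have [N _ NP] := residual_small e0.
have decr n : (N <= n)%N -> `|c - x n| < e -> `|c - x n.+1| <= `|c - x n|.
  move=> Nn ce; have [i [_ zi]] := iteration_piece n.
  exact: (norm_decrease (step_towards_fixpoint zi (eP n ce (NP n Nn) i zi))).
have stay k n : (N <= k)%N -> `|c - x k| < e -> (k <= n)%N -> `|c - x n| <= `|c - x k|.
  move=> Nk ke; elim: n => [|n ih]; first by rewrite leqn0 => /eqP ->.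
  rewrite leq_eqVlt => /predU1P[<-//|]; rewrite ltnS => kn.
  apply: le_trans (ih kn); apply: decr; first exact: leq_trans Nk kn.
  exact: le_lt_trans (ih kn) ke.
have xc : x @ \oo --> c.
  apply/cvgrPdist_lt => t t0.
  have [k Nk] := cc (Num.min e t) (ltac:(by rewrite lt_min e0)) N.
  rewrite lt_min => /andP[ke kt]; exists k => // n /= kn.
  exact: le_lt_trans (stay k n Nk ke kn) kt.
split => //; apply/(DR_fixE g gamma_gt0 f_convex).
have act : \forall n \near \oo, active gamma f g g_ (x n) `<=` active gamma f g g_ c.
  exact: xc _ (active_outer_semicontinuous gamma_gt0 g_min_convex f_convex c).
have ball_c : \forall n \near \oo, `|c - x n| < e by move/cvgrPdist_lt : xc; apply.
have [n [[actn cn] zn]] := filter_ex (filterI (filterI act ball_c) (residual_small e0)).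
have [i [ai zi]] := iteration_piece n.
apply: (prox_min_convex g_min_convex (eP n cn zn i zi)).
exact: (actn _ ai).
Qed.

End douglas_rachford_convergence.

(** * The radius of attraction *)

Section attraction.
Context {R : realType} {X : finHilbertType R} {I : finType}.
Variables (gamma : R) (f : X -> R) (g : X -> \bar R) (g_ : I -> X -> \bar R).
Hypotheses (gamma_gt0 : 0 < gamma) (g_min_convex : min_convex g g_).
Hypothesis f_convex : convex_function [set: convex_lmodType X] f.

Lemma attraction_radius_gt0 xs : (0 < attraction_radius gamma f g g_ xs)%E.
Proof.
have /nbhs_ballP[d /= d0 dP] :=
  active_outer_semicontinuous gamma_gt0 g_min_convex f_convex xs.
apply: (@lt_le_trans _ _ (d / 2)%:E); first by rewrite lte_fin divr_gt0.
apply: ereal_sup_ubound; exists (d / 2) => //; split; first exact: divr_gt0.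
move=> u; rewrite /cball /= lee_fin => ud; apply: dP; rewrite -ball_normE /=.
by apply: le_lt_trans ud _; rewrite ltr_pdivrMr// ltr_pMr// ltr1n.
Qed.

Lemma attraction_radius_gtP xs u :
  (`|xs - u|%:E < attraction_radius gamma f g g_ xs)%E ->
  exists2 d, `|xs - u| <= d & forall v, cball xs d%:E v ->
    active gamma f g g_ v `<=` active gamma f g g_ xs.
Proof.
move=> /ereal_sup_gt[_ [d [d0 dP] <-]]; rewrite lte_fin => /ltW ud.
by exists d.
Qed.

End attraction.

(** Moving an interior point [u] slightly away from [x] stays in the ball and
    increases the distance to [x]. *)
Lemma interior_cball (R : realType) (X : finHilbertType R) (x u : X) (r : \bar R) :
  (0 < r)%E -> interior (cball x r) u -> (`|x - u|%:E < r)%E.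
Proof.
move=> r0 /nbhs_ballP[e /= e0 eP].
have [->|xu] := eqVneq (x - u) 0; first by rewrite normr0.
have n0 : 0 < `|x - u| by rewrite normr_gt0.
pose s := e / 2 / `|x - u|; have s0 : 0 < s by rewrite !divr_gt0.
have : ball u e (u - s *: (x - u)).
  rewrite -ball_normE /= opprB addrC subrK normrZ gtr0_norm// /s divfK ?gt_eqF//.
  by rewrite ltr_pdivrMr// ltr_pMr// ltr1n.
move=> /eP; rewrite /cball /= opprB addrCA addrC.
apply: lt_le_trans; rewrite lte_fin -{2}[x - u]scale1r -scalerDl normrZ.
by rewrite gtr0_norm ?addr_gt0// ltr_pMl// ltrDl.
Qed.

Theorem theorem6p5 (R : realType) (X : finHilbertType R) (I : finType)
    (f : X -> R) (g : X -> \bar R) (g_ : I -> X -> \bar R) (gamma : R)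
    (xs : X) (lambda : nat -> R)
    (f_convex : convex_function [set: convex_lmodType X] f)
    (g_min_convex : min_convex g g_)
    (gamma_gt0 : 0 < gamma)
    (xs_fix : strongFix (DR gamma f g) xs)
    (lambda_in : forall n, 0 < lambda n <= 2)
    (lambda_liminf :
      (0 < limn_einf (fun n => (lambda n * (2 - lambda n))%:E))%E) :
  let r := attraction_radius gamma f g g_ xs in
  (forall x y z : nat -> X,
    interior (cball xs r) (x 0%N) ->
    DR_iteration gamma f g lambda x y z ->
    exists xbar : X,
      x @ \oo --> xbar /\ (Fix (DR gamma f g) `&` cball xs r) xbar) /\
  (exists r' : \bar R, (0 < r' <= r)%E /\
    forall x y z : nat -> X,
      interior (cball xs r') (x 0%N) ->
      DR_iteration gamma f g lambda x y z ->
      exists xbar : X,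
        x @ \oo --> xbar /\
        local_min (fun u => ((f u)%:E + g u)%E)
          (prox_pt gamma (EFin \o f) xbar)).
Proof.
move=> r.
have r0 : (0 < r)%E by exact: attraction_radius_gt0.
have conv (x y z : nat -> X) : interior (cball xs r) (x 0%N) ->
    DR_iteration gamma f g lambda x y z ->
    exists c, [/\ x @ \oo --> c, Fix (DR gamma f g) c & cball xs r c].
  move=> /(interior_cball r0) x0r xyz.
  have [d x0d dP] := attraction_radius_gtP x0r.
  have [c [xc cfix cb]] := DR_iteration_converges gamma_gt0 g_min_convex f_convex
    xs_fix lambda_in lambda_liminf xyz dP x0d.
  by exists c; split => //; apply: le_trans (ltW x0r); rewrite lee_fin.
split=> [x y z x0 /(conv _ _ _ x0)[c [xc cfix cb]]|]; first by exists c.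
exists r; split=> [|x y z x0 /(conv _ _ _ x0)[c [xc cfix _]]].
  by rewrite r0 lexx.
exists c; split => //.
exact: (DR_fix_local_min gamma_gt0 g_min_convex f_convex).
Qed.
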